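(* Let $p$ be a prime and let $\alpha\in\{-v,\,p,\,p/u\}$ if $p$ is odd, and $\alpha\in\{1,\pm2,\pm5,\pm10\}$ if $p=2$. Let $A_\alpha=\mathrm{diag}(1,\alpha)$ and $SO(2)_p^\alpha=\{L\in M_{2\times2}(\mathbb{Q}_p): L^\top A_\alpha L=A_\alpha,\ \det L=1\}$. For $\sigma\in\mathbb{Q}_p$ define $$\mathcal{R}(\sigma)=\begin{pmatrix}\frac{1-\alpha\sigma^2}{1+\alpha\sigma^2} & -\frac{2\alpha\sigma}{1+\alpha\sigma^2}\\ \frac{2\sigma}{1+\alpha\sigma^2} & \frac{1-\alpha\sigma^2}{1+\alpha\sigma^2}\end{pmatrix},$$ and $\mathcal{R}(\infty)=-I$. Then every element of $SO(2)_p^\alpha$ is of the form $\mathcal{R}(\sigma)$ for some $\sigma\in\mathbb{Q}_p\cup\{\infty\}$, and the map $\sigma\mapsto\mathcal{R}(\sigma)$ on $\mathbb{Q}_p\cup\{\infty\}$ is injective.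
   Context: For $p$ odd, $u\in\mathbb{Z}_p^\times$ is a fixed unit that is not a square in $\mathbb{Q}_p$, and $v=-u$ if $p\equiv1\pmod 4$, $v=-1$ if $p\equiv 3\pmod 4$. The forms $x^2+\alpha y^2$ for these values of $\alpha$ are (up to scaling: $ux^2+py^2=u(x^2+\frac{p}{u}y^2)$) representatives of the equivalence classes of binary quadratic forms over $\mathbb{Q}_p$ not representing $0$ nontrivially; in particular $1+\alpha\sigma^2\neq0$ for all $\sigma\in\mathbb{Q}_p$. *)

(* Defs.v *)
From HB Require Import structures.
From mathcomp Require Import all_boot all_algebra.
From mathcomp Require Import boolp.

Set Implicit Arguments.
Unset Strict Implicit.
Unset Printing Implicit Defensive.

Import GRing.Theory.
Local Open Scope ring_scope.

(* Z_p as the inverse limit of the rings Z/p^n: the n-th component is the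
   representative in [0, p^n) of the residue class mod p^n (the condition
   below forces this bound).  The primality proof is a parameter of the type
   because Z_p must be an integral domain. *)
Definition padic_coherent (p : nat) (x : nat -> nat) : Prop :=
  forall n, x n = (x n.+1 %% p ^ n)%N.

Record padic_int (p : nat) (p_pr : prime p) := PadicInt {
  padic_res :> nat -> nat;
  padic_resP : padic_coherent p padic_res }.

HB.instance Definition _ p p_pr := gen_eqMixin (@padic_int p p_pr).
HB.instance Definition _ p p_pr := gen_choiceMixin (@padic_int p p_pr).

Section PadicIntRing.
Variables (p : nat) (p_pr : prime p).
Local Notation Zp := (padic_int p_pr).
Implicit Types x y z : Zp.

Lemma padic_int_eq x y : padic_res x = padic_res y -> x = y.
Proof.
case: x y => [x xP] [y yP] /= exy; case: y / exy yP => yP.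
by congr PadicInt; exact: Prop_irrelevance.
Qed.

Lemma padic_int_ext x y : (forall n, padic_res x n = padic_res y n) -> x = y.
Proof. by move=> exy; apply: padic_int_eq; apply: funext. Qed.

Lemma padic_res_mod x n : (x n %% p ^ n)%N = x n.
Proof. by rewrite (padic_resP x n) modn_mod. Qed.

Lemma modn_expS m n : ((m %% p ^ n.+1) %% p ^ n = m %% p ^ n)%N.
Proof. by rewrite modn_dvdm // dvdn_exp2l. Qed.

Lemma padic_resD x n k : (x (n + k)%N %% p ^ n)%N = x n.
Proof.
elim: k => [|k IHk]; first by rewrite addn0 padic_res_mod.
rewrite -[RHS]IHk (padic_resP x (n + k)) addnS.
by rewrite modn_dvdm // dvdn_exp2l ?leq_addr.
Qed.

Fact padic_const_proof (m : nat) :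
  padic_coherent p (fun n => m %% p ^ n)%N.
Proof. by move=> n /=; rewrite modn_expS. Qed.
Definition padic_const m : Zp := PadicInt p_pr (padic_const_proof m).

Fact padic_add_proof x y :
  padic_coherent p (fun n => (x n + y n) %% p ^ n)%N.
Proof.
by move=> n /=; rewrite modn_expS (padic_resP x n) (padic_resP y n) modnDm.
Qed.
Definition padic_add x y : Zp := PadicInt p_pr (padic_add_proof x y).

Fact padic_mul_proof x y :
  padic_coherent p (fun n => (x n * y n) %% p ^ n)%N.
Proof.
by move=> n /=; rewrite modn_expS (padic_resP x n) (padic_resP y n) modnMm.
Qed.
Definition padic_mul x y : Zp := PadicInt p_pr (padic_mul_proof x y).

Lemma padic_res_lt x n : (x n < p ^ n)%N.
Proof. by rewrite -padic_res_mod ltn_mod expn_gt0 prime_gt0. Qed.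

Fact padic_opp_proof x :
  padic_coherent p (fun n => (p ^ n - x n) %% p ^ n)%N.
Proof.
move=> n /=; rewrite modn_expS; apply/eqP.
have le_x k : (x k <= p ^ k)%N by rewrite ltnW // padic_res_lt.
rewrite -(eqn_modDr (x n)) subnK // modnn.
rewrite {1}(padic_resP x n) modnDmr subnK //.
by rewrite eq_sym; apply: dvdn_exp2l.
Qed.
Definition padic_opp x : Zp := PadicInt p_pr (padic_opp_proof x).

Fact padic_addA : associative padic_add.
Proof.
by move=> x y z; apply: padic_int_ext => n /=; rewrite modnDmr modnDml addnA.
Qed.

Fact padic_addC : commutative padic_add.
Proof. by move=> x y; apply: padic_int_ext => n /=; rewrite addnC. Qed.

Fact padic_add0 : left_id (padic_const 0) padic_add.
Proof.
by move=> x; apply: padic_int_ext => n /=; rewrite mod0n add0n padic_res_mod.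
Qed.

Fact padic_addN : left_inverse (padic_const 0) padic_opp padic_add.
Proof.
move=> x; apply: padic_int_ext => n /=.
by rewrite modnDml subnK ?modnn ?mod0n // ltnW // padic_res_lt.
Qed.

HB.instance Definition _ := GRing.isZmodule.Build Zp
  padic_addA padic_addC padic_add0 padic_addN.

Fact padic_mulA : associative padic_mul.
Proof.
by move=> x y z; apply: padic_int_ext => n /=; rewrite modnMmr modnMml mulnA.
Qed.

Fact padic_mulC : commutative padic_mul.
Proof. by move=> x y; apply: padic_int_ext => n /=; rewrite mulnC. Qed.

Fact padic_mul1 : left_id (padic_const 1) padic_mul.
Proof.
by move=> x; apply: padic_int_ext => n /=; rewrite modnMml mul1n padic_res_mod.
Qed.

Fact padic_mulDl : left_distributive padic_mul padic_add.
Proof.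
move=> x y z; apply: padic_int_ext => n /=.
by rewrite modnMml modnDm mulnDl.
Qed.

Fact padic_1_neq0 : padic_const 1 != 0.
Proof.
apply/eqP => /(congr1 (fun x : Zp => x 1%N)) /=.
by rewrite expn1 mod0n modn_small // prime_gt1.
Qed.

HB.instance Definition _ := GRing.Zmodule_isComNzRing.Build Zp
  padic_mulA padic_mulC padic_mul1 padic_mulDl padic_1_neq0.

Definition padic_unit : {pred Zp} := fun x => `[< exists y, y * x = 1 >].

Definition padic_inv x : Zp :=
  if pselect (exists y, y * x = 1) is left ex then projT1 (cid ex) else x.

Fact padic_mulV : {in padic_unit, left_inverse 1 padic_inv *%R}.
Proof.
move=> x /asboolP xU; rewrite /padic_inv; case: pselect => // ex.
by case: cid.
Qed.

Fact padic_unitP x y : y * x = 1 -> padic_unit x.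
Proof. by move=> yx1; apply/asboolP; exists y. Qed.

Fact padic_inv_out : {in [predC padic_unit], padic_inv =1 id}.
Proof.
move=> x /negP xNU; rewrite /padic_inv; case: pselect => // ex.
by case: xNU; apply/asboolP.
Qed.

HB.instance Definition _ := GRing.ComNzRing_hasMulInverse.Build Zp
  padic_mulV padic_unitP padic_inv_out.

Lemma padic_neq0 x : x != 0 -> exists n, (0 < x n)%N.
Proof.
move=> x0; apply: contrapT => /forallNP xz; case/eqP: x0.
apply: padic_int_ext => n /=; rewrite mod0n; apply/eqP.
by rewrite eqn0Ngt; apply/negP.
Qed.

Fact padic_idomain (x y : Zp) : x * y = 0 -> (x == 0) || (y == 0).
Proof.
move=> xy0; rewrite -[_ || _]negbK negb_or; apply/negP => /andP[].
case/padic_neq0=> m xm /padic_neq0[n yn].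
have ndvd (z : Zp) a b : (0 < z a)%N -> ~~ (p ^ a %| z (a + b))%N.
  by move=> za; rewrite /dvdn padic_resD -lt0n.
have xN := ndvd x m n xm; have := ndvd y n m yn; rewrite addnC => yN.
have pos (z : Zp) a k : ~~ (p ^ a %| z k)%N -> (0 < z k)%N.
  by rewrite lt0n; apply: contra => /eqP ->; rewrite dvdn0.
have x0 := pos _ _ _ xN; have y0 := pos _ _ _ yN.
move: xN yN; rewrite !pfactor_dvdn // -!ltnNge => xN yN.
have /(congr1 (fun z : Zp => z (m + n)%N)) /= := xy0; rewrite mod0n => /eqP.
rewrite -/(dvdn _ _) pfactor_dvdn ?muln_gt0 ?x0 // lognM //.
by rewrite leqNgt -addSn leq_add // ltnW.
Qed.

HB.instance Definition _ :=
  GRing.ComUnitRing_isIntegral.Build Zp padic_idomain.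

End PadicIntRing.

Notation padic p_pr := {fraction padic_int p_pr}.
Notation "x %:F" := (@FracField.tofrac _ x) : ring_scope.

Definition mx22 (R : Type) (a b c d : R) : 'M[R]_2 :=
  \matrix_(i, j) if i == 0 then (if j == 0 then a else b)
                 else (if j == 0 then c else d).

Section SpecialOrthogonal.
Variables (p : nat) (p_pr : prime p).
Local Notation Zp := (padic_int p_pr).
Local Notation Qp := (padic p_pr).

Definition nonsquare_unit (u : Zp) : Prop :=
  u \is a GRing.unit /\ ~ (exists x : Qp, x ^+ 2 = u%:F).

Definition form_v (u : Zp) : Qp :=
  if (p %% 4 == 1)%N then - u%:F else -1.

(* For p = 2 the parameter u plays no role. *)
Definition form_coef (u : Zp) (alpha : Qp) : Prop :=
  if p == 2%N then alpha \in [:: 1; 2; -2; 5; -5; 10; -10]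
  else alpha \in [:: - form_v u; p%:R; p%:R / u%:F].

Definition form_mx (alpha : Qp) : 'M[Qp]_2 :=
  diag_mx (\row_j if j == 0 then 1 else alpha).

Definition SO2 (alpha : Qp) (L : 'M[Qp]_2) : Prop :=
  L^T *m form_mx alpha *m L = form_mx alpha /\ \det L = 1.

(* None is the point at infinity.  For the alpha allowed by form_coef, -alpha
   is not a square, so d below never vanishes. *)
Definition rot_mx (alpha : Qp) (s : option Qp) : 'M[Qp]_2 :=
  if s is Some sigma then
    let d := 1 + alpha * sigma ^+ 2 in
    mx22 ((1 - alpha * sigma ^+ 2) / d) (- (2 * alpha * sigma / d))
         (2 * sigma / d)                ((1 - alpha * sigma ^+ 2) / d)
  else - 1%:M.

End SpecialOrthogonal.

(* Main.v *)
(* Since [2 != 0] and [- alpha] is not a square in Q_p, a matrix of SO(2) is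
   determined by its first column [(a, c)], a point of [a^2 + alpha c^2 = 1], and
   [sigma = c / (1 + a)] is the slope of the line joining it to [(-1, 0)], the
   point whose matrix is [-I].
   That [- alpha] is not a square is seen on Z_p: writing [- alpha = p^e c] with
   [p] not dividing [c], a square root forces [e] even and [z^2 = c w^2] with [p]
   not dividing [w].  This is impossible mod 8 when [p = 2] and [c] is [-1, 5] or
   [-5], and mod p when [c = -1] and [p = 3 mod 4].  When [p = 1 mod 4], [-1] is a
   square in Z_p, so [- u] is a square only if [u] is. *)
Require Import Defs.
From mathcomp Require Import all_boot all_algebra all_field.
From mathcomp Require Import ring zify.

Set Implicit Arguments.
Unset Strict Implicit.
Unset Printing Implicit Defensive.

Import GRing.Theory.
Local Open Scope ring_scope.

(** * Rational parametrization of the conic [a^2 + alpha c^2 = 1] over a field *)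

Section CayleyParametrization.
Context {F : fieldType} {alpha : F}.
Hypothesis two_neq0 : (2 : F) != 0.
Hypothesis anisotropic : forall x : F, x ^+ 2 != - alpha.

Let alpha_neq0 : alpha != 0.
Proof. by apply: contraTneq (anisotropic 0) => ->; rewrite expr0n oppr0 eqxx. Qed.

(** A zero of the denominator would make [s^-1] a square root of [- alpha]. *)
Let den_neq0 s : 1 + alpha * s ^+ 2 != 0.
Proof.
have [->|s0] := eqVneq s 0; first by rewrite expr0n mulr0 addr0 oner_eq0.
apply: contraNneq (anisotropic s^-1) => h; apply/eqP.
have -> : - alpha = s ^- 2 - (1 + alpha * s ^+ 2) * s ^- 2 by field.
by rewrite h mul0r subr0 exprVn.
Qed.

(* For [L = [[a, b], [c, d]]], the equation [L^T A L = A] is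
   [L^T A = A L^-1], where [L^-1] is the adjugate of [L] as [\det L = 1]. *)
Lemma orthogonal_entries (a b c d : F) :
    a ^+ 2 + alpha * c ^+ 2 = 1 -> a * b + alpha * c * d = 0 ->
    a * d - b * c = 1 ->
  d = a /\ b = - (alpha * c).
Proof.
move=> h1 h2 h3; split.
  have -> : d = (a ^+ 2 + alpha * c ^+ 2) * d by rewrite h1 mul1r.
  have -> : (a ^+ 2 + alpha * c ^+ 2) * d =
    a * (a * d - b * c) + c * (a * b + alpha * c * d) by ring.
  by rewrite h2 h3; ring.
have -> : b = (a ^+ 2 + alpha * c ^+ 2) * b by rewrite h1 mul1r.
have -> : (a ^+ 2 + alpha * c ^+ 2) * b =
  a * (a * b + alpha * c * d) - alpha * c * (a * d - b * c) by ring.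
by rewrite h2 h3; ring.
Qed.

Lemma cayley_surj {a c : F} : a ^+ 2 + alpha * c ^+ 2 = 1 ->
  (a = -1 /\ c = 0) \/
  exists s, a = (1 - alpha * s ^+ 2) / (1 + alpha * s ^+ 2)
         /\ c = 2 * s / (1 + alpha * s ^+ 2).
Proof.
move=> h; have [a1|a1] := eqVneq (1 + a) 0.
  have aE : a = -1 by apply/eqP; rewrite -addr_eq0 addrC a1.
  left; split=> //; move/eqP: h.
  rewrite aE sqrrN expr1n -subr_eq0 addrAC subrr add0r mulf_eq0.
  by rewrite (negPf alpha_neq0) expf_eq0 /= => /eqP.
right; exists (c / (1 + a)).
have dE : 1 + alpha * (c / (1 + a)) ^+ 2 = 2 / (1 + a).
  (* The subtracted term vanishes on the conic; it turns the numerator into [2 (1 + a)]. *)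
  have -> : 1 + alpha * (c / (1 + a)) ^+ 2 =
    ((1 + a) ^+ 2 + alpha * c ^+ 2 - (a ^+ 2 + alpha * c ^+ 2 - 1))
      / (1 + a) ^+ 2 by rewrite h subrr subr0; field.
  by field.
have nE : 1 - alpha * (c / (1 + a)) ^+ 2 = 2 - 2 / (1 + a).
  by rewrite -dE; ring.
by rewrite nE dE; split; field; rewrite two_neq0 a1.
Qed.

(** Adding 1 gives [2 / (1 + alpha s^2)]. Hence no finite parameter yields [-I], and the slope
    [c / (1 + a)] is defined at every finite parameter. *)
Lemma cayley_cos_neqN1 {s : F} :
  (1 - alpha * s ^+ 2) / (1 + alpha * s ^+ 2) != -1.
Proof.
have d0 := den_neq0 s; rewrite -addr_eq0.
have -> : (1 - alpha * s ^+ 2) / (1 + alpha * s ^+ 2) + 1 =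
  2 / (1 + alpha * s ^+ 2) by field.
by rewrite mulf_eq0 invr_eq0 (negPf two_neq0) (negPf d0).
Qed.

(** The parameter is recovered from the first column of its matrix, which gives injectivity. *)
Lemma cayley_slope {s : F} :
  s = 2 * s / (1 + alpha * s ^+ 2)
      / (1 + (1 - alpha * s ^+ 2) / (1 + alpha * s ^+ 2)).
Proof.
have := cayley_cos_neqN1 (s := s); rewrite -addr_eq0 addrC => h.
have := den_neq0 s => d0.
have -> : 1 + (1 - alpha * s ^+ 2) / (1 + alpha * s ^+ 2) =
  2 / (1 + alpha * s ^+ 2) by field.
by field; rewrite d0 two_neq0.
Qed.

End CayleyParametrization.

(** * Factoring out powers of [p] in Z_p, and squares in Q_p *)

Lemma frac_numden {R : idomainType} (x : {fraction R}) :
  exists a b : R, b != 0 /\ x * b%:F = a%:F.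
Proof.
elim/quotW: x => r; exists (frac r).1, (frac r).2; split.
  exact: denom_ratioP.
rewrite !piE; apply/eqmodP; rewrite /= FracField.equivfE /FracField.mulf.
by rewrite !numden_Ratio ?(oner_eq0, mulf_neq0, denom_ratioP) // !mulr1 mulrC.
Qed.

Section PadicSquares.
Context {p : nat} {p_pr : prime p}.
Local Notation Zp := (padic_int p_pr).
Local Notation Qp := (padic p_pr).
Implicit Types (x y c w : Zp).

Lemma padic_res_add x y n : (x + y) n = ((x n + y n) %% p ^ n)%N.
Proof. by []. Qed.

Lemma padic_res_mul x y n : (x * y) n = ((x n * y n) %% p ^ n)%N.
Proof. by []. Qed.

Lemma padic_res_nat m n : (m%:R : Zp) n = (m %% p ^ n)%N.
Proof.
elim: m => [|m IHm]; first by [].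
by rewrite -natr1 padic_res_add IHm /= modnDm addn1.
Qed.

Lemma padic_natr_neq0 m : (0 < m)%N -> (m%:R : Zp) != 0.
Proof.
move=> m0; apply/eqP => /(congr1 (fun x : Zp => x m)).
rewrite padic_res_nat /= mod0n modn_small; last by rewrite ltn_expl ?prime_gt1.
by move=> mE; rewrite mE in m0.
Qed.

Lemma padic_res_modp x n : (x n.+1 %% p)%N = x 1%N.
Proof. by have := padic_resD x 1 n; rewrite expn1 add1n. Qed.

(** Euclid's lemma for [p]: [x 1 = 0] expresses that [p] divides [x]. *)
Lemma padic_res1_mul_eq0 x y :
  ((x * y) 1%N == 0%N) = (x 1%N == 0%N) || (y 1%N == 0%N).
Proof.
by rewrite padic_res_mul expn1 -/(dvdn _ _) Euclid_dvdM // /dvdn !padic_res_modp.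
Qed.

Lemma padic_unit_res1 x : x \is a GRing.unit -> x 1%N != 0%N.
Proof.
move=> xU; have := padic_res1_mul_eq0 x^-1 x; rewrite mulVr // => h.
apply/negP => x1; move: h; rewrite x1 orbT /= expn1 modn_small //.
exact: prime_gt1.
Qed.

(** Division by [p] shifts the residue sequence by one index. The explicit residues of the quotient
    drive the induction in [padic_factor]. *)
Lemma padic_p_mulP x : x 1%N = 0%N ->
  exists y, x = p%:R * y /\ forall n, y n = (x n.+1 %/ p)%N.
Proof.
move=> x1.
have yP : padic_coherent p (fun n => x n.+1 %/ p)%N.
  by move=> n; rewrite modn_divl mulnC -expnS -padic_resP.
exists (PadicInt p_pr yP); split=> //; apply: padic_int_ext => n.
rewrite padic_res_mul padic_res_nat modnMml /= mulnC divnK -?padic_resP //.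
by rewrite /dvdn padic_res_modp x1.
Qed.

(** Induction on the index of a nonzero residue, which each division by [p] lowers by one. *)
Lemma padic_factor x : x != 0 ->
  exists n w, x = p%:R ^+ n * w /\ w 1%N != 0%N.
Proof.
move=> /padic_neq0[n]; elim: n x => [|n IHn] x xn.
  (* The residue mod [p^0 = 1] is always 0, so this case is void. *)
  by move: (padic_res_lt x 0); rewrite expn0 ltnS leqn0 eqn0Ngt xn.
have [x1|x1] := eqVneq (x 1%N) 0%N; last by exists 0, x; rewrite expr0 mul1r.
have [y [xE yE]] := padic_p_mulP x1.
have pdvd : (p %| x n.+1)%N by rewrite /dvdn padic_res_modp x1.
have yn : (0 < y n)%N by rewrite yE divn_gt0 ?prime_gt0 // dvdn_leq.
have [m [w [yw w1]]] := IHn y yn.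
by exists m.+1, w; rewrite xE yw mulrA -exprS.
Qed.

(** After cancelling [p^a], a strict inequality [a < b] would make [p] divide [w]. *)
Lemma padic_factor_le a b w c : w 1%N != 0%N -> (a <= b)%N ->
  p%:R ^+ a * w = p%:R ^+ b * c -> a = b /\ w = c.
Proof.
move=> w1 ab; rewrite -(subnKC ab) exprD -mulrA.
have pa0 : (p%:R : Zp) ^+ a != 0.
  by rewrite expf_neq0 // padic_natr_neq0 ?prime_gt0.
move/(mulfI pa0); case: (b - a)%N => [|k] wE.
  by rewrite addn0 wE expr0 mul1r.
case/negP: w1; rewrite wE exprS -mulrA padic_res1_mul_eq0 padic_res_nat.
by rewrite expn1 modnn.
Qed.

Lemma padic_factor_inj a b w c : w 1%N != 0%N -> c 1%N != 0%N ->
  p%:R ^+ a * w = p%:R ^+ b * c -> a = b /\ w = c.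
Proof.
move=> w1 c1; case: (leqP a b) => [ab|/ltnW ba]; first exact: padic_factor_le.
by move/esym/(padic_factor_le c1 ba) => [-> ->].
Qed.

(** With [x = a / b], one has [a^2 = p^e c b^2] in Z_p. Factoring [a = p^n z] and [b = p^m w] and
    comparing both sides gives [2n = e + 2m] and [z^2 = c w^2]. *)
Lemma padic_frac_square e c (x : Qp) : c 1%N != 0%N ->
  x ^+ 2 = (p%:R ^+ e * c)%:F ->
  ~~ odd e /\ exists z w, w 1%N != 0%N /\ z ^+ 2 = c * w ^+ 2.
Proof.
move=> c1 xE; have [a [b [b0 xb]]] := frac_numden x.
have abE : a ^+ 2 = p%:R ^+ e * c * b ^+ 2.
  by apply/eqP; rewrite -tofrac_eq [X in _ == X]tofracM -xE !tofracXn -xb exprMn.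
have c0 : c != 0 by apply: contraNneq c1 => ->; rewrite /= mod0n.
have a0 : a != 0.
  rewrite -sqrf_eq0 abE !mulf_neq0 ?expf_neq0 //.
  by rewrite padic_natr_neq0 ?prime_gt0.
have [n [z [aE z1]]] := padic_factor a0.
have [m [w [bE w1]]] := padic_factor b0.
have /padic_factor_inj[] : p%:R ^+ (n * 2) * z ^+ 2 =
    p%:R ^+ (e + m * 2) * (c * w ^+ 2).
- by rewrite exprM -exprMn -aE abE bE exprD exprM exprMn; ring.
- by rewrite expr2 padic_res1_mul_eq0 negb_or z1.
- by rewrite expr2 !padic_res1_mul_eq0 !negb_or c1 w1.
move=> neq zE; split; last by exists z, w.
by have := congr1 odd neq; rewrite oddD !oddM !andbF addbF => <-.
Qed.

Lemma padic_res_exp x k n : (x ^+ k) n = (x n ^ k %% p ^ n)%N.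
Proof.
elim: k => [|k IHk]; first by [].
by rewrite exprS padic_res_mul IHk modnMmr expnS.
Qed.

Lemma padic_res_opp x n : (- x) n = ((p ^ n - x n) %% p ^ n)%N.
Proof. by []. Qed.

Lemma padic_frac_two_neq0 : (2 : Qp) != 0.
Proof. by rewrite -(rmorph_nat (@FracField.tofrac Zp)) tofrac_eq0 padic_natr_neq0. Qed.

End PadicSquares.

(** * Teichmueller lifts and a square root of -1 *)

(** In [a^p - b^p = (a - b) S], the sum [S] has [p] terms, all congruent to [b^(p-1)] mod [p], so it
    contributes one more factor [p]. *)
Lemma eqn_mod_expp p n a b : (0 < p)%N -> (a = b %[mod p ^ n.+1] ->
  a ^ p = b ^ p %[mod p ^ n.+2])%N.
Proof.
(* The order makes the truncated subtraction [a - b] exact. *)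
move=> p0; wlog ba : a b / (b <= a)%N => [hw|].
  case: (leqP b a) => [|/ltnW] le_ab ab; first exact: hw.
  by apply/esym/hw.
move=> ab; have abp : (a = b %[mod p])%N.
  have pdvd : (p %| p ^ n.+1)%N by rewrite expnS dvdn_mulr.
  by rewrite -(modn_dvdm a pdvd) ab modn_dvdm.
move/eqP: ab; rewrite eqn_mod_dvd // => dvd_ab.
apply/eqP; rewrite eqn_mod_dvd ?leq_exp2r // subn_exp expnSr dvdn_mul //.
rewrite /dvdn -modn_summ (eq_bigr (fun=> b ^ p.-1 %% p)%N) => [|i _].
  by rewrite sum_nat_const card_ord modnMr.
rewrite -modnMml -modnXm abp modnXm modnMml -expnD subnK //.
by rewrite -ltnS prednK.
Qed.

(** Fermat's little theorem starts the induction; each [p]-th power improves the modulus by one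
    factor [p]. *)
Lemma eqn_mod_exp_prime_pow p n a : prime p ->
  (a ^ (p ^ n.+1) = a ^ (p ^ n) %[mod p ^ n.+1])%N.
Proof.
move=> p_pr; elim: n => [|n IHn]; first by rewrite !expn1; exact: fermat_little.
by have := eqn_mod_expp (prime_gt0 p_pr) IHn; rewrite -!expnM -!expnSr.
Qed.

(* [w] is the limit of [a^(p^n)]. *)
Lemma padic_teichmuller p (p_pr : prime p) a :
  exists w : padic_int p_pr, w ^+ p = w /\ w 1%N = (a %% p)%N.
Proof.
have expE n : (a ^ (p ^ n.+1) = a ^ (p ^ n) %[mod p ^ n])%N.
  rewrite -(modn_expS p) (eqn_mod_exp_prime_pow n a p_pr).
  by rewrite modn_expS.
have wP : padic_coherent p (fun n => a ^ (p ^ n) %% p ^ n)%N.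
  by move=> n; rewrite modn_expS expE.
exists (PadicInt p_pr wP); split; last by rewrite /= !expn1 fermat_little.
apply: padic_int_ext => n.
by rewrite padic_res_exp /= modnXm -expnM -expnSr expE.
Qed.

(** Otherwise [X^k - 1] would have [p - 1 > k] roots in ['F_p]. *)
Lemma exists_expn_modp_neq1 p k : prime p -> (0 < k < p.-1)%N ->
  exists a, ~~ (p %| a)%N /\ (a ^ k != 1 %[mod p])%N.
Proof.
move=> p_pr /andP[k0 kp].
have [x /andP[x0 xk]] : exists x : 'F_p, (x != 0) && (x ^+ k != 1).
  apply/existsP; rewrite -[[exists _, _]]negbK negb_exists.
  apply/negP => /forallP roots.
  have : (size (enum (predC1 (0%R : 'F_p))) < size ('X^k - 1%:P : {poly 'F_p})%R)%N.
    apply: max_poly_roots; rewrite ?enum_uniq //.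
      by rewrite -size_poly_eq0 size_XnsubC.
    apply/allP => x; rewrite mem_enum inE => x0.
    rewrite rootE !hornerE subr_eq0; move: (roots x).
    by rewrite x0 /= negbK.
  by rewrite -cardE cardC1 card_Fp // size_XnsubC // ltnS leqNgt kp.
exists (nat_of_ord x); have xE : (nat_of_ord x)%:R = x by apply: natr_Zp.
split.
  by rewrite (dvdn_pcharf (pchar_Fp p_pr)) xE.
apply: contraNneq xk => ak; rewrite -xE -natrX -(Fp_nat_mod p_pr) ak.
by rewrite Fp_nat_mod.
Qed.

(* A Teichmueller lift [w] of an [a] with [a^((p-1)/2) != 1 mod p] satisfies
   [w^((p-1)/2) = -1], so [w^((p-1)/4)] is a square root of [-1]. *)
Lemma padic_sqrtN1 p (p_pr : prime p) : (p %% 4 = 1)%N ->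
  exists i : padic_int p_pr, i ^+ 2 = -1.
Proof.
move=> p4; have p1 := prime_gt1 p_pr.
pose k := (p %/ 4)%N; have pE : p = (2 * (2 * k)).+1 by rewrite /k; lia.
have [|a [pa ak]] := @exists_expn_modp_neq1 p (2 * k) p_pr; first by lia.
have [w [wp w1]] := padic_teichmuller p_pr a.
have w0 : w != 0.
  by apply: contraNneq pa => w0; rewrite /dvdn -w1 w0 /= mod0n.
have wk : (w ^+ (2 * k)) ^+ 2 = 1.
  apply: (mulfI w0); rewrite mulr1 -exprM -exprS -[RHS]wp.
  by congr (_ ^+ _); lia.
exists (w ^+ k); rewrite -exprM mulnC; apply/eqP.
move/eqP: wk; rewrite sqrf_eq1 => /orP[/eqP wk1|//].
case/negP: ak; have := congr1 (fun z : padic_int p_pr => z 1%N) wk1.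
by rewrite padic_res_exp w1 /= expn1 modnXm => ->.
Qed.

(** * Obstructions to being a square, mod [p] and mod 8 *)

(** If [b] is nonzero mod [p], raising [a^2 = - b^2] to the odd power [(p - 1) / 2] gives [1 = -1]
    in ['F_p] by Fermat, whence [p] divides 2. *)
Lemma dvdn_sum_squares p a b : prime p -> (p %% 4 = 3)%N ->
  (p %| a ^ 2 + b ^ 2)%N -> (p %| b)%N.
Proof.
move=> p_pr p4; rewrite !(dvdn_pcharf (pchar_Fp p_pr)) natrD !natrX.
move: (a%:R : 'F_p) (b%:R : 'F_p) => {a b} a b; rewrite addr_eq0 => /eqP abE.
apply/negPn/negP => b0.
have a0 : a != 0 by rewrite -sqrf_eq0 abE oppr_eq0 sqrf_eq0.
pose k := (p %/ 4)%N; have pE : p = (2 * (2 * k).+1).+1 by rewrite /k; lia.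
have fermat (x : 'F_p) : x != 0 -> (x ^+ 2) ^+ (2 * k).+1 = 1.
  move=> x0; apply: (mulfI x0); rewrite mulr1 -exprM -exprS -pE.
  by have := expf_card x; rewrite card_Fp.
have := fermat a a0; rewrite abE exprNn fermat // mulr1.
rewrite exprS exprM sqrrN expr1n expr1n mulr1 => /eqP.
rewrite eq_sym -subr_eq0 opprK -(natrD _ 1 1) -(dvdn_pcharf (pchar_Fp p_pr)).
by move/dvdn_leq => /(_ isT); have := prime_gt1 p_pr; lia.
Qed.

(** Odd squares are 1 mod 8, so the right side is [c], whereas squares mod 8 are 0, 1 or 4. The
    proof runs through all residues of [z] and [w]. *)
Lemma odd_square_mod8 c z w : c \in [:: 3; 5; 7]%N -> odd w ->
  (z ^ 2 != c * w ^ 2 %[mod 8])%N.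
Proof.
move=> cP wodd.
have sq8 m : (m ^ 2 %% 8 = (m %% 8) ^ 2 %% 8)%N by rewrite modnXm.
rewrite -modnMmr sq8 (sq8 w).
have : odd (w %% 8) by rewrite -[8%N]/(2 * 4)%N; lia.
have := ltn_pmod w (isT : 0 < 8)%N; have := ltn_pmod z (isT : 0 < 8)%N.
move: (z %% 8)%N (w %% 8)%N; move: cP; rewrite !inE.
by case/or3P => /eqP ->; do 8?[case=> //]; do 8?[case=> //].
Qed.

(** * The negatives of the allowed coefficients are not squares *)

Lemma form_coef2_anisotropic (pr2 : prime 2) (u : padic_int pr2) alpha
    (x : padic pr2) : form_coef u alpha -> x ^+ 2 != - alpha.
Proof.
(* [c 3] is the residue mod [2^3 = 8]. Odd [e] settles [alpha] among [2, -2, 10, -10]; for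
   [1, 5, -5] the residue of [- alpha] is 7, 3, 5. *)
have nonsq e (c : padic_int pr2) : c 1%N != 0%N ->
    odd e || (c 3 \in [:: 3; 5; 7]%N) -> x ^+ 2 != (2%:R ^+ e * c)%:F.
  move=> c1 ec; apply/eqP => /(padic_frac_square c1)[/negPf oe [z [w [w1 zw]]]].
  rewrite oe /= in ec.
  have wodd : odd (w 3).
    by move: w1; rewrite -(padic_res_modp w 2) modn2 eqb0 negbK.
  have /eqP[] := odd_square_mod8 (z 3) ec wodd.
  have <- : (z ^+ 2) 3 = (z 3 ^ 2 %% 8)%N by rewrite padic_res_exp.
  by rewrite zw padic_res_mul padic_res_exp modnMmr.
have natF n : (n%:R : padic_int pr2)%:F = n%:R := rmorph_nat _ n.
pose c5 : padic_int pr2 := 5%:R; pose one : padic_int pr2 := 1.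
have r5 k : c5 k = (5 %% 2 ^ k)%N by apply: padic_res_nat.
rewrite /form_coef /= !inE.
case/or4P => [|||/or4P[|||]] /eqP ->.
- have -> : -1 = (2%:R ^+ 0 * - one)%:F by rewrite expr0 mul1r tofracN tofrac1.
  exact: nonsq.
- have -> : -2 = (2%:R ^+ 1 * - one)%:F by rewrite expr1 mulrN1 tofracN natF.
  exact: nonsq.
- have -> : - -2 = (2%:R ^+ 1 * one)%:F by rewrite expr1 mulr1 opprK natF.
  exact: nonsq.
- have -> : -5 = (2%:R ^+ 0 * - c5)%:F by rewrite expr0 mul1r tofracN natF.
  by apply: nonsq; rewrite padic_res_opp r5.
- have -> : - -5 = (2%:R ^+ 0 * c5)%:F by rewrite expr0 mul1r opprK natF.
  by apply: nonsq; rewrite r5.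
- have -> : -10 = (2%:R ^+ 1 * - c5)%:F.
    by rewrite expr1 mulrN tofracN tofracM !natF -natrM.
  by apply: nonsq; rewrite padic_res_opp r5.
have -> : - -10 = (2%:R ^+ 1 * c5)%:F.
  by rewrite expr1 opprK tofracM !natF -natrM.
by apply: nonsq; rewrite r5.
Qed.

Lemma form_coef_odd_anisotropic p (p_pr : prime p) (u : padic_int p_pr) alpha
    (x : padic p_pr) :
  odd p -> nonsquare_unit u -> form_coef u alpha -> x ^+ 2 != - alpha.
Proof.
move=> p_odd [uU u_nsq].
have unit1 (c : padic_int p_pr) : c \is a GRing.unit -> c 1%N != 0%N.
  exact: padic_unit_res1.
(* The exponent 1 of [p] is odd; this serves for [alpha = p] and [alpha = p / u]. *)
have ramified (c : padic_int p_pr) :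
    c \is a GRing.unit -> x ^+ 2 != (p%:R ^+ 1 * c)%:F.
  by move=> cU; apply/eqP => /(padic_frac_square (unit1 _ cU))[].
have natF n : (n%:R : padic_int p_pr)%:F = n%:R := rmorph_nat _ n.
have uF0 : u%:F != 0 by rewrite tofrac_eq0; apply: contraTneq uU => ->; rewrite unitr0.
rewrite /form_coef; case: eqP => [p2|_]; first by rewrite p2 in p_odd.
rewrite !inE => /or3P[] /eqP ->.
- rewrite opprK /form_v; case: ifP => /eqP p4.
    have [i iE] := padic_sqrtN1 p_pr p4.
    (* Here [x^2 = - u], so [i x] would be a square root of [u]. *)
    apply/eqP => xE; apply: u_nsq; exists (i%:F * x).
    by rewrite exprMn -tofracXn iE xE tofracN tofrac1 mulN1r opprK.
  have p43 : (p %% 4 = 3)%N by lia.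
  have N1U : (-1 : padic_int p_pr) \is a GRing.unit by rewrite unitrN1.
  apply/eqP => xE.
  have [||_ [z [w [w1 zw]]]] := @padic_frac_square p p_pr 0 (-1) x.
  + exact: unit1.
  + by rewrite expr0 mul1r tofracN tofrac1.
  (* From [z^2 = - w^2], [p] divides the sum of the squares of the residues of [z] and [w], hence
     divides [w]. *)
  case/negP: w1; rewrite -(padic_res_modp w 0) -/(dvdn _ _).
  apply: (@dvdn_sum_squares p (z 1%N)) => //.
  have /(congr1 (fun y : padic_int p_pr => y 1%N)) : z ^+ 2 + w ^+ 2 = 0.
    by rewrite zw mulN1r addNr.
  by rewrite padic_res_add !padic_res_exp modnDm expn1 /= mod0n /dvdn => ->.
- have -> : - p%:R = (p%:R ^+ 1 * -1 : padic_int p_pr)%:F.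
    by rewrite expr1 mulrN1 tofracN natF.
  by apply: ramified; rewrite unitrN1.
have -> : - (p%:R / u%:F) = (p%:R ^+ 1 * - u^-1)%:F.
  rewrite expr1 mulrN tofracN tofracM natF; congr (- (_ * _)).
  by apply: (mulIf uF0); rewrite mulVf // -tofracM mulVr // tofrac1.
by apply: ramified; rewrite unitrN unitrV.
Qed.

(** * Matrices of size 2 and the parametrization of the group *)

Lemma matrix2P (R : Type) (A B : 'M[R]_2) :
  A 0 0 = B 0 0 -> A 0 1 = B 0 1 -> A 1 0 = B 1 0 -> A 1 1 = B 1 1 -> A = B.
Proof.
move=> e00 e01 e10 e11; apply/matrixP => i j.
have ord2 (k : 'I_2) : k = 0 \/ k = 1.
  by case: k => [[|[|//]] lt_k]; [left | right]; apply: val_inj.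
by case: (ord2 i) (ord2 j) => -> [] ->.
Qed.

Lemma det_mx2 (R : comNzRingType) (A : 'M[R]_2) :
  \det A = A 0 0 * A 1 1 - A 0 1 * A 1 0.
Proof.
rewrite (expand_det_row _ 0) big_ord_recl big_ord1 /cofactor !det_mx11 !mxE /=.
have -> : lift ord0 ord0 = 1 :> 'I_2 by apply: val_inj.
have -> : lift 1 0 = 0 :> 'I_2 by apply: val_inj.
by rewrite expr0 expr1 mul1r mulN1r mulrN.
Qed.

(** The entries (0,0) and (0,1) of [L^T A L = A], together with the determinant, are the hypotheses
    of [orthogonal_entries]. *)
Lemma SO2_entries p (p_pr : prime p) (alpha : padic p_pr) L : SO2 alpha L ->
  [/\ L 0 0 ^+ 2 + alpha * L 1 0 ^+ 2 = 1, L 1 1 = L 0 0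
    & L 0 1 = - (alpha * L 1 0)].
Proof.
case=> LE detL.
have entry i j : L 0 i * L 0 j + alpha * (L 1 i) * (L 1 j) = form_mx alpha i j.
  rewrite -LE /form_mx mul_mx_diag !mxE big_ord_recl big_ord1 !mxE /=.
  have -> : lift ord0 ord0 = 1 :> 'I_2 by apply: val_inj.
  by rewrite mulr1 (mulrC alpha).
have := entry 0 0; have := entry 0 1.
rewrite !mxE /= ?mulr1n ?mulr0n => e01 e00.
have e0 : L 0 0 ^+ 2 + alpha * L 1 0 ^+ 2 = 1 by rewrite -e00; ring.
have [|-> ->//] := orthogonal_entries e0 e01.
by rewrite -detL det_mx2.
Qed.

Theorem theorem7 (p : nat) (p_pr : prime p)
    (u : padic_int p_pr) (u_nonsq : odd p -> nonsquare_unit u)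
    (alpha : padic p_pr) (alphaP : form_coef u alpha) :
  (forall L : 'M[padic p_pr]_2,
      SO2 alpha L -> exists sigma : option (padic p_pr), L = rot_mx alpha sigma)
  /\ injective (rot_mx alpha).
Proof.
have anis (x : padic p_pr) : x ^+ 2 != - alpha.
  have [p2|p_odd] := even_prime p_pr; last first.
    exact: form_coef_odd_anisotropic (u_nonsq p_odd) alphaP.
  by subst p; apply: form_coef2_anisotropic alphaP.
have two0 := padic_frac_two_neq0 (p_pr := p_pr).
split=> [L /SO2_entries[e0 e11 e01]|].
  have [[a1 c0]|[s [aE cE]]] := cayley_surj two0 anis e0.
    exists None; apply: matrix2P.
    - by rewrite a1 !mxE.
    - by rewrite e01 c0 !mxE mulr0 oppr0.
    - by rewrite c0 !mxE oppr0.
    - by rewrite e11 a1 !mxE.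
  exists (Some s); apply: matrix2P; rewrite ?e01 ?e11 ?aE ?cE !mxE //=.
  by rewrite mulrA mulrCA mulrA.
(* Injectivity is read off the first column: two finite parameters are compared through the slope,
   while a finite one and infinity differ in the top left entry, which is -1 only at infinity. *)
have col0 s : (rot_mx alpha (Some s) 0 0 =
      (1 - alpha * s ^+ 2) / (1 + alpha * s ^+ 2))
    * (rot_mx alpha (Some s) 1 0 = 2 * s / (1 + alpha * s ^+ 2)).
  by split; rewrite !mxE.
move=> [s|] [t|] // stE.
- congr Some; rewrite (cayley_slope two0 anis (s := s)).
  by rewrite (cayley_slope two0 anis (s := t)) -!col0 stE.
- case/eqP: (cayley_cos_neqN1 two0 anis (s := s)).
  by rewrite -col0 stE !mxE.
case/eqP: (cayley_cos_neqN1 two0 anis (s := t)).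
by rewrite -col0 -stE !mxE.
Qed.
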